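(* Let $p=(p_i)_{i=1}^n$, $q=(q_i)_{i=1}^n$ be lattice paths with $p\preceq q$ such that the strong lattice path matroid $M=M[p,q]$ on $E=\{1,\ldots,n\}$ has no loops and no parallel elements, and $\operatorname{rk}_M(E)\ge 2$. Let $N_q=\{i\in E\mid q_i=\mathrm{N}\}$, $j_1=\max N_q$, and $j_2=\max(N_q\setminus\{j_1\})$. Then: (i) $W=\{1,2,\ldots,j_2-1\}$ is a coline of $M$ (called the Western coline of $M$). (ii) $\{1,2,\ldots,j_1-1\}$ is a copoint on $W$, and it is a multiple copoint on $W$ whenever $j_1-j_2\ge 2$. (iii) For every $k\in E$ with $k\ge j_1$, the set $W\cup\{k\}$ is a simple copoint on $W$.
   Context: A lattice path of length $n$ is a tuple $(r_i)_{i=1}^n\in\{\mathrm{N},\mathrm{E}\}^n$. For lattice paths $p,q$ of length $n$, we write $p\preceq q$ if for all $k$, $|\{i\le k\mid p_i=\mathrm{N}\}|\le|\{i\le k\mid q_i=\mathrm{N}\}|$, with equality for $k=n$. $\mathrm{P}[p,q]=\{r\mid p\preceq r\preceq q\}$. For $p\preceq q$, the strong lattice path matroid $M[p,q]$ is the transversal matroid on $\{1,\ldots,n\}$ presented by the family $(A_i)_{i=1}^m$, $m=|\{i\mid q_i=\mathrm{N}\}|$, where $A_i$ is the set of $j$ such that some $r\in\mathrm{P}[p,q]$ has $r_j=\mathrm{N}$ and $|\{k\le j\mid r_k=\mathrm{N}\}|=i$. A coline of a matroid $M$ on $E$ is a flat $X$ with $\operatorname{rk}_M(X)=\operatorname{rk}_M(E)-2$.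 A copoint on a coline $X$ is a flat $Y\supseteq X$ with $\operatorname{rk}_M(Y)=\operatorname{rk}_M(E)-1$; it is simple if $|Y\setminus X|=1$ and multiple if $|Y\setminus X|>1$. *)

(* Defs.v *)
From HB Require Import structures.
From mathcomp Require Import all_boot.

Set Implicit Arguments.
Unset Strict Implicit.
Unset Printing Implicit Defensive.

Record matroid (T : finType) := Matroid {
  indep : pred {set T};
  indep0 : indep set0;
  indepS : forall I J : {set T}, I \subset J -> indep J -> indep I;
  indep_aug : forall I J : {set T}, indep I -> indep J -> #|I| < #|J| ->
    exists2 y, y \in J :\: I & indep (y |: I)
}.

Section MatroidNotions.
Variables (T : finType) (M : matroid T).
Implicit Types (x y : T) (A X Y : {set T}).

Definition rk A : nat := \max_(I : {set T} | (I \subset A) && indep M I) #|I|.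

Definition loop x : bool := ~~ indep M [set x].

Definition parallel x y : bool :=
  [&& x != y, ~~ loop x, ~~ loop y & ~~ indep M [set x; y]].

Definition flat X : bool := [forall (x | x \notin X), rk X < rk (x |: X)].

(* Ranks are compared additively: subtraction on nat is truncated. *)
Definition coline X : bool := flat X && (rk X + 2 == rk [set: T]).

Definition copoint_on X Y : bool :=
  [&& flat Y, X \subset Y & rk Y + 1 == rk [set: T]].

Definition simple_copoint_on X Y : bool := copoint_on X Y && (#|Y :\: X| == 1).

Definition multiple_copoint_on X Y : bool := copoint_on X Y && (1 < #|Y :\: X|).

End MatroidNotions.

Section Transversal.
Variables (T I : finType) (A : I -> {set T}).
Implicit Types (X Y : {set T}) (f : {ffun T -> option I}).

(* f matches X into the family: it is injective on X, and every x in X is sent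
   to an index of a set containing x. The codomain is [option I] because I may
   be empty; None is never a legal value on X. *)
Definition matching X f : bool :=
  dinjectiveb f (mem X) &&
  [forall x in X, if f x is Some i then x \in A i else false].

Definition partial_transversal X : bool := [exists f, matching X f].

Lemma matchingP X f :
  reflect ({in X &, injective f} /\
           {in X, forall x, exists2 i, f x = Some i & x \in A i})
          (matching X f).
Proof.
apply: (iffP andP) => -[inj fA]; split.
- exact/dinjectiveP.
- move=> x xX; move/forall_inP: fA => /(_ x xX).
  by case: (f x) => // i xi; exists i.
- exact/dinjectiveP.
- by apply/forall_inP => x /fA [i -> ->].
Qed.

Lemma partial_transversal0 : partial_transversal set0.
Proof.
apply/existsP; exists [ffun=> None]; apply/matchingP.
by split=> x; rewrite inE.
Qed.

Lemma partial_transversalS X Y :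
  X \subset Y -> partial_transversal Y -> partial_transversal X.
Proof.
move=> /subsetP sXY /existsP[f /matchingP[inj fA]].
apply/existsP; exists f; apply/matchingP; split.
  by move=> x y /sXY xY /sXY yY; apply: inj.
by move=> x /sXY; apply: fA.
Qed.

Lemma partial_transversal_aug X Y :
  partial_transversal X -> partial_transversal Y -> #|X| < #|Y| ->
  exists2 y, y \in Y :\: X & partial_transversal (y |: X).
Proof.
move=> /existsP[f mf] /existsP[g /matchingP[gI gA]] ltXY.
have [d] := ubnP #|[set x in X | f x != g x]|.
elim: d f mf => // d IHd f /matchingP[fI fA] led.
have [y yY gy] : exists2 y, y \in Y & g y \notin f @: X.
  have /subsetPn[_ /imsetP[y yY ->] gy] : ~~ (g @: Y \subset f @: X).
    apply: contraL ltXY => /subset_leq_card.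
    by rewrite !card_in_imset // leqNgt.
  by exists y.
pose h : {ffun T -> option I} := [ffun x => if x == y then g y else f x].
have hE x : x != y -> h x = f x by rewrite ffunE => /negPf->.
have hy : h y = g y by rewrite ffunE eqxx.
have mh : matching (y |: X) h.
  have key x : x \in y |: X -> x != y -> x \in X.
    by rewrite !inE => /orP[->|].
  apply/matchingP; split=> [x z xX zX|x xX].
    have [->|nx] := eqVneq x y; have [->|nz] := eqVneq z y => //.
    + rewrite hy hE // => e; case/negP: gy; rewrite e.
      exact/imset_f/key.
    + rewrite hy hE // => e; case/negP: gy; rewrite -e.
      exact/imset_f/key.
    + by rewrite !hE //; apply: fI; apply: key.
  have [->|nx] := eqVneq x y; first by rewrite hy; apply: gA.
  by rewrite hE //; apply: fA; apply: key.
have [yX|yX] := boolP (y \in X); last first.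
  by exists y; [rewrite inE yX | apply/existsP; exists h].
have eyX : y |: X = X by apply/setUidPr; rewrite sub1set.
rewrite eyX in mh; apply: (IHd h mh).
rewrite ltnS in led; apply: leq_trans led; apply: proper_card.
apply/properP; split.
  apply/subsetP => x; rewrite !inE => /andP[-> /=].
  by have [->|nx] := eqVneq x y; rewrite ?hy ?eqxx // hE.
exists y; rewrite !inE ?hy ?eqxx ?andbF // yX /=.
by apply: contraNneq gy => <-; apply: imset_f.
Qed.

Definition transversal_matroid : matroid T :=
  Matroid partial_transversal0 partial_transversalS partial_transversal_aug.

End Transversal.

Inductive step := North | East.

Definition bool_of_step s := if s is North then true else false.
Definition step_of_bool b := if b then North else East.
Lemma bool_of_stepK : cancel bool_of_step step_of_bool. Proof. by case. Qed.
HB.instance Definition _ := Finite.copy step (can_type bool_of_stepK).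

(* Positions are 0-based throughout: the ordinal i : 'I_n stands for the element
   i + 1 of {1, ..., n}. *)
Section LatticePaths.
Variable n : nat.
Implicit Types p q r : n.-tuple step.

Definition north_set r : {set 'I_n} := [set i | tnth r i == North].

Definition height r (k : nat) : nat := #|[set i in north_set r | i < k]|.

Definition lpath_le p q : bool :=
  [forall k : 'I_n.+1, height p k <= height q k] && (height p n == height q n).

Definition paths_between p q : {set n.-tuple step} :=
  [set r | lpath_le p r && lpath_le r q].

(* The index i stands for i + 1: A_i collects the positions at which a path
   between p and q can make its (i + 1)-st north step. *)
Definition lpm_family p q (i : 'I_#|north_set q|) : {set 'I_n} :=
  [set j | [exists r in paths_between p q,
              (tnth r j == North) && (height r j.+1 == i.+1)]].

Definition lpm p q : matroid 'I_n := transversal_matroid (@lpm_family p q).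

End LatticePaths.

(* Main.v *)
(** Write [h_r k] for the number of north steps of [r] before position [k].  The
    family presenting the matroid is [A_i = {j | h_p j <= i < h_q (j + 1)}], so
    the rank of an initial segment [{x | x < k}] is [h_q k], attained by the
    north steps of [q] in it.  With [m] the rank of the matroid, this gives the
    segments below [j2] and [j1] the ranks [m - 2] and [m - 1].  Looplessness
    puts every position from [j2] on in [A_(m-2)] (if below [j1]) or in
    [A_(m-1)] (if not), indices and positions starting at 0.
    Two positions from [j1] on cannot both belong to [A_(m-1)] only, since they
    would be parallel; hence they can be matched to the last two sets. *)
Require Import Defs.
From mathcomp Require Import all_boot zify.

Set Implicit Arguments.
Unset Strict Implicit.
Unset Printing Implicit Defensive.

(** * Rank and flatness in a matroid *)

Section MatroidRank.
Variables (T : finType) (M : matroid T).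
Implicit Types (x : T) (I X Y : {set T}).

Lemma rk_geq X I : I \subset X -> indep M I -> #|I| <= rk M X.
Proof. by move=> sIX iI; apply: (leq_bigmax_cond I); rewrite sIX. Qed.

Lemma rk_leqP X c :
  (forall I, I \subset X -> indep M I -> #|I| <= c) -> rk M X <= c.
Proof. by move=> le_c; apply/bigmax_leqP=> I /andP[]; apply: le_c. Qed.

Lemma rk_setU1 x X : rk M (x |: X) <= (rk M X).+1.
Proof.
apply: rk_leqP => I sI iI.
have : #|I :\ x| <= rk M X.
  apply: rk_geq; first by rewrite subDset.
  exact: indepS (subsetDl _ _) iI.
by rewrite (cardsD1 x I); lia.
Qed.

(** Reduces flatness to exhibiting, for each outside point, an independent set larger than the
    rank. *)
Lemma flat_indep X :
  (forall x, x \notin X ->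
     exists I, [/\ I \subset x |: X, indep M I & rk M X < #|I|]) ->
  flat M X.
Proof.
move=> ext; apply/forall_inP => x /ext[I [sI iI ltI]].
exact: leq_trans ltI (rk_geq sI iI).
Qed.

End MatroidRank.

(** * Heights of lattice paths *)

Section Height.
Variable n : nat.
Implicit Types r : n.-tuple step.

Lemma heightS r (k : 'I_n) : height r k.+1 = height r k + (k \in north_set r).
Proof.
rewrite /height (cardsD1 k) !inE ltnSn andbT addnC; congr (_ + _).
by apply: eq_card => x; rewrite !inE ltnS (leq_eqVlt x) -(inj_eq val_inj) /=;
   case: ltngtP => //=; rewrite ?andbF ?orbT ?andbT.
Qed.

Lemma height0 r : height r 0 = 0.
Proof. by apply: eq_card0 => x; rewrite !inE andbF. Qed.

Lemma height_mono r k l : k <= l -> height r k <= height r l.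
Proof.
move=> le_kl; apply/subset_leq_card/subsetP => x; rewrite !inE.
by case/andP=> -> /leq_trans->.
Qed.

Lemma height_full r : height r n = #|north_set r|.
Proof. by apply: eq_card => x; rewrite !inE ltn_ord andbT. Qed.

(** Allows a path to be built from prescribed heights. *)
Lemma height_of_increments r (h : nat -> nat) :
  h 0 = 0 -> (forall k : 'I_n, h k.+1 = h k + (k \in north_set r)) ->
  forall k, k <= n -> height r k = h k.
Proof.
move=> h0 hS; elim=> [|k IHk] ltkn; first by rewrite height0.
by rewrite (heightS r (Ordinal ltkn)) (hS (Ordinal ltkn)) IHk // ltnW.
Qed.

Lemma lpath_leP (p q : n.-tuple step) :
  reflect ((forall k, k <= n -> height p k <= height q k) /\
           height p n = height q n)
          (lpath_le p q).
Proof.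
apply: (iffP andP) => [[/forallP le_pq /eqP]|[le_pq ->]]; split=> //.
  by move=> k lekn; apply: (le_pq (Ordinal (lekn : k < n.+1))).
by apply/forallP=> k; apply: le_pq; rewrite -ltnS.
Qed.

End Height.

(** * The presenting sets as intervals, independence as labelling, and ranks *)

Section LatticePathMatroid.
Variables (n : nat) (p q : n.-tuple step).
Hypothesis le_pq : lpath_le p q.
Implicit Types (x y : 'I_n) (X : {set 'I_n}).

(* For the reverse inclusion, the path with heights [min (h_q k) i] for [k <= j]
   and [max (h_p k) (i + 1)] for [k > j] makes its (i + 1)-st north step at
   [j]. *)
Lemma lpm_familyE (i : 'I_#|north_set q|) j :
  (j \in lpm_family p i) = (height p j <= i < height q j.+1).
Proof.
have [leh eqh] := lpath_leP _ _ le_pq.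
rewrite inE; case: i => /= i; rewrite -height_full => le_in.
apply/exists_inP/idP => [[r]|/andP[le_pi lt_iq]].
  rewrite inE => /andP[/lpath_leP[le_pr _] /lpath_leP[le_rq _]].
  case/andP=> rj /eqP hr; have := heightS r j; rewrite inE rj hr.
  have := le_pr j (ltnW (ltn_ord j)); have := le_rq j.+1 (ltn_ord j).
  lia.
pose h k := if k <= j then minn (height q k) i else maxn (height p k) i.+1.
pose r : n.-tuple step := [tuple step_of_bool (h k < h k.+1) | k < n].
have hE k : k <= n -> height r k = h k.
  apply: height_of_increments => [|{}k]; first by rewrite /h height0 min0n.
  have rk_north : (k \in north_set r) = (h k < h k.+1).
    by rewrite inE tnth_mktuple; case: (h k < h k.+1).
  (* Heights of [p] and [q] grow by at most one per step, hence so does [h]. At [k = j] the bounds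
     on [i] force the values [i] and [i + 1], so the two pieces fit together. *)
  rewrite rk_north; have := heightS q k; have := heightS p k.
  have := heightS q j; have := heightS p j; rewrite /h.
  case: (ltngtP k j) => [lt_kj|lt_jk|/val_inj->]; last by rewrite ?ltnn; lia.
    by lia.
  by lia.
exists r.
  rewrite inE; apply/andP; split; apply/lpath_leP; split.
  - move=> k lekn; rewrite hE // /h; case: (leqP k j) => lekj; last by lia.
    have := leh k lekn; have := height_mono p lekj; lia.
  - rewrite hE // /h leqNgt ltn_ord /=; lia.
  - move=> k lekn; rewrite hE // /h; case: (leqP k j) => lekj; first by lia.
    have := leh k lekn; have := height_mono q lekj; lia.
  - rewrite hE // /h leqNgt ltn_ord /=; lia.
have jn := ltn_ord j.
have hj : h j = i by have := heightS q j; rewrite /h leqnn; lia.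
have hj1 : h j.+1 = i.+1 by have := heightS p j; rewrite /h ltnn; lia.
by rewrite tnth_mktuple hE // hj hj1 ltnSn eqxx.
Qed.

(** A matching into the presenting family, with numbers as indices; the labels from [c] on stay free
    for further elements. *)
Definition labelled X c :=
  exists2 f : 'I_n -> nat, {in X &, injective f} &
    {in X, forall x, (height p x <= f x < height q x.+1) && (f x < c)}.

Lemma labelled_setU1 X c i x :
  labelled X c -> c <= i -> height p x <= i < height q x.+1 ->
  labelled (x |: X) i.+1.
Proof.
(* Without the [clear], [lia] would make the lemma depend on [le_pq]. *)
clear le_pq; move=> [f injf fX] le_ci xi.
exists (fun y => if y == x then i else f y).
  move=> y z; rewrite !inE.
  case: eqVneq => [->|_] /=; case: eqVneq => [->|_] //=.
  - by move=> _ /fX/andP[_ lt_f] e; lia.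
  - by move=> /fX/andP[_ lt_f] _ e; lia.
  - exact: injf.
move=> y; rewrite !inE; case: eqVneq => [->|_] /=; first by rewrite xi ltnSn.
by move=> /fX/andP[-> /=]; lia.
Qed.

Lemma indep_labelled X c : labelled X c -> indep (lpm p q) X.
Proof.
move=> [f injf fX]; apply/existsP; exists [ffun x => insub (f x)].
(* Labels on [X] are genuine indices, so [insub] yields [None] only off [X]. *)
have lt_f x : x \in X -> f x < #|north_set q|.
  move=> /fX/andP[/andP[_ lt_fq] _]; rewrite -height_full.
  exact: leq_trans lt_fq (height_mono q (ltn_ord x)).
apply/matchingP; split=> [x y xX yX|x xX]; rewrite !ffunE.
  rewrite !insubT ?lt_f // => _ _ [e]; exact: injf.
rewrite (insubT (fun i => i < #|north_set q|) (lt_f x xX)).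
eexists; first by [].
by rewrite lpm_familyE; have /andP[] := fX x xX.
Qed.

Lemma indep_height X :
  indep (lpm p q) X -> exists2 f : 'I_n -> nat, {in X &, injective f} &
    {in X, forall x, height p x <= f x < height q x.+1}.
Proof.
move=> /existsP[f /matchingP[injf fX]].
exists (fun x => if f x is Some i then i : nat else 0).
  move=> x y xX yX; have [i fx _] := fX x xX; have [j fy _] := fX y yX.
  rewrite fx fy => e; apply: injf => //; rewrite fx fy.
  by congr Some; apply: val_inj.
by move=> x xX; have [i -> ] := fX x xX; rewrite lpm_familyE.
Qed.

Definition north_below k : {set 'I_n} := [set x in north_set q | x < k].

(** Each north step of [q] is labelled by the height at which it starts; this is admissible because
    [p] stays weakly below [q]. *)
Lemma labelled_north_below k :
  k <= n -> labelled (north_below k) (height q k).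
Proof.
have [leh _] := lpath_leP _ _ le_pq.
have lt_h x l : x \in north_set q -> x < l -> height q x < height q l.
  by move=> xN /(height_mono q); rewrite heightS xN; lia.
move=> lekn; exists (fun x => height q x).
  move=> x y; rewrite ![_ \in north_below _]inE.
  move=> /andP[xN _] /andP[yN _] e; apply: val_inj => /=.
  by case: (ltngtP x y) => // [/(lt_h _ _ xN)|/(lt_h _ _ yN)]; rewrite e ltnn.
move=> x; rewrite inE => /andP[xN ltxk].
by rewrite !lt_h // leh // ltnW.
Qed.

Lemma rk_lpm_leq X c :
  (forall x, x \in X -> height q x.+1 <= c) -> rk (lpm p q) X <= c.
Proof.
move=> le_c; apply: rk_leqP => I /subsetP sIX /indep_height[f injf fI].
have lt_f x : x \in I -> f x < c.
  by move=> xI; have := fI x xI; have := le_c x (sIX x xI); lia.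
(* A nonempty [I] forces [c] to be positive, as the codomain ['I_c.+1] of [inord] requires after the
   shift. *)
have [->|[x0 x0I]] := set_0Vmem I; first by rewrite cards0.
have c_gt0 : 0 < c by have := lt_f x0 x0I; lia.
case: c {le_c} lt_f c_gt0 => // c lt_f _.
rewrite -(card_ord c.+1) -(@card_in_imset _ _ (fun x => inord (f x) : 'I_c.+1)).
  exact: max_card.
move=> x y xI yI /(congr1 val); rewrite /= !inordK ?lt_f //; exact: injf.
Qed.

Lemma rk_initial_segment k :
  k <= n -> rk (lpm p q) [set x : 'I_n | x < k] = height q k.
Proof.
move=> lekn; apply/eqP; rewrite eqn_leq rk_lpm_leq /= => [|x]; last first.
  by rewrite inE; apply: height_mono.
apply: (@rk_geq _ _ _ (north_below k)).
  by apply/subsetP=> x; rewrite !inE => /andP[].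
exact: indep_labelled (labelled_north_below lekn).
Qed.

Lemma rk_lpm : rk (lpm p q) [set: 'I_n] = height q n.
Proof.
rewrite -rk_initial_segment //; congr (rk _ _).
by apply/setP=> x; rewrite !inE ltn_ord.
Qed.

Lemma height_nonloop x : ~~ loop (lpm p q) x -> height p x < height q x.+1.
Proof.
rewrite negbK => /indep_height[f _ /(_ x)].
rewrite inE eqxx => /(_ isT); lia.
Qed.

(** The pair is independent, and a matching gives it two distinct labels. *)
Lemma height_nonparallel x y :
  ~~ loop (lpm p q) x -> ~~ loop (lpm p q) y -> x != y ->
  ~~ parallel (lpm p q) x y ->
  exists i j, [/\ i != j, height p x <= i < height q x.+1 &
                  height p y <= j < height q y.+1].
Proof.
rewrite /parallel => -> -> neq_xy; rewrite neq_xy /= negbK.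
move=> /indep_height[f injf fX].
have xX : x \in [set x; y] by rewrite !inE eqxx.
have yX : y \in [set x; y] by rewrite !inE eqxx orbT.
exists (f x), (f y); split; try exact: fX.
by apply: contra neq_xy => /eqP/(injf _ _ xX yX)->.
Qed.

End LatticePathMatroid.

(** * The last two north steps of [q] *)

Section LastNorths.
Variables (n : nat) (q : n.-tuple step).

Lemma height_last_north (j1 := \max_(i in north_set q) (i : nat)) :
  0 < height q n -> [/\ j1 < n, (height q j1).+1 = height q n &
                       forall x : 'I_n, j1 <= x -> height q x.+1 = height q n].
Proof.
move=> m_gt0; have N_gt0 : 0 < #|north_set q| by rewrite -height_full.
(* Since [q] has a north step, [j1] is attained and is not the default 0 of an empty maximum. *)
have [i iN def_j1] := eq_bigmax_cond (fun i : 'I_n => i : nat) N_gt0.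
have full k : j1 < k -> height q k = height q n.
  move=> ltk; apply: eq_card => x; rewrite !inE ltn_ord.
  case xN: (_ == _) => //=; apply: leq_ltn_trans ltk.
  by apply: (leq_bigmax_cond x); rewrite inE.
have hj : (height q j1).+1 = height q n.
  by rewrite -(full _ (ltnSn j1)) /j1 def_j1 heightS iN addn1.
by split=> // [|x lex]; [rewrite /j1 def_j1 | rewrite full].
Qed.

Lemma height_second_last_north (j1 := \max_(i in north_set q) (i : nat))
    (j2 := \max_(i in north_set q | (i : nat) != j1) (i : nat)) :
  1 < height q n ->
  [/\ j2 < j1, (height q j2).+2 = height q n &
      forall x : 'I_n, j2 <= x < j1 -> (height q x.+1).+1 = height q n].
Proof.
move=> m_gt1; have [lt_j1n hj1 _] := height_last_north (ltnW m_gt1).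
have lt_j1 (i : 'I_n) : i \in north_set q -> (i : nat) != j1 -> i < j1.
  by move=> iN neq; rewrite ltn_neqAle neq; apply: (leq_bigmax_cond i).
(* The height before [j1] is still positive, so a second north step exists and [j2] is attained
   too. *)
have gt0 : 0 < #|[pred i : 'I_n | (i \in north_set q) && ((i : nat) != j1)]|.
  have : 0 < height q j1 by rewrite /j1; lia.
  case/card_gt0P=> i; rewrite inE => /andP[iN ltij].
  by apply/card_gt0P; exists i; rewrite inE iN ltn_eqF.
have [i] := eq_bigmax_cond (fun i : 'I_n => i : nat) gt0.
rewrite inE => /andP[iN neqi] def_j2.
have {}def_j2 : j2 = i by rewrite -def_j2; apply: eq_bigl.
have full k : j2 < k <= j1 -> height q k = height q j1.
  move=> /andP[ltk lek]; apply: eq_card => x; rewrite !inE.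
  case xN: (_ == _) => //=; apply/idP/idP => [/leq_trans->//|ltx].
  by apply: leq_ltn_trans ltk; apply: leq_bigmax_cond; rewrite inE xN ltn_eqF.
have lt_j21 : j2 < j1 by rewrite def_j2 lt_j1.
split=> //.
  have := full j2.+1; rewrite ltnSn lt_j21 => /(_ isT).
  by rewrite def_j2 heightS iN -/j1 in hj1 *; lia.
by move=> x /andP[le_x lt_x]; rewrite full ?hj1 // ltnS le_x lt_x.
Qed.

End LastNorths.

(** * The Western coline and its copoints *)

Theorem mainTheorem3 (n : nat) (p q : n.-tuple step)
    (hpq : lpath_le p q)
    (hloop : forall x : 'I_n, ~~ loop (lpm p q) x)
    (hparallel : forall x y : 'I_n, ~~ parallel (lpm p q) x y)
    (hrk : 2 <= rk (lpm p q) [set: 'I_n]) :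
  let M := lpm p q in
  let j1 := \max_(i in north_set q) (i : nat) in
  let j2 := \max_(i in north_set q | (i : nat) != j1) (i : nat) in
  let W := [set x : 'I_n | x < j2] in
  let Y := [set x : 'I_n | x < j1] in
  [/\ coline M W,
      copoint_on M W Y /\ (2 <= j1 - j2 -> multiple_copoint_on M W Y)
    & forall k : 'I_n, j1 <= k -> simple_copoint_on M W (k |: W)].
Proof.
move=> M j1 j2 W Y.
rewrite rk_lpm // in hrk.
have [lt_j1n hj1 top1] := height_last_north (ltnW hrk).
have [lt_j21 hj2 top2] := height_second_last_north hrk.
rewrite -/j1 -/j2 in lt_j1n hj1 top1 lt_j21 hj2 top2.
have lt_j2n := ltn_trans lt_j21 lt_j1n.
have rkW : rk M W = height q j2 by rewrite rk_initial_segment // ltnW.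
have rkY : rk M Y = height q j1 by rewrite rk_initial_segment // ltnW.
have rkE : rk M setT = height q n by rewrite rk_lpm.
have hx (x : 'I_n) := height_nonloop hpq (hloop x).
have segment_sub k : north_below q k \subset [set x : 'I_n | x < k].
  by apply/subsetP=> x; rewrite !inE => /andP[].
have labW := labelled_north_below hpq (ltnW lt_j2n).
have labY := labelled_north_below hpq (ltnW lt_j1n).
have notin_below k (x : 'I_n) : k <= x -> x \notin north_below q k.
  by move=> lekx; rewrite inE ltnNge lekx andbF.
have sWY : W \subset Y.
  by apply/subsetP=> x; rewrite !inE => /ltn_trans->.
have top2_leq (x : 'I_n) : j2 <= x -> height q n <= (height q x.+1).+1.
  by move=> le2; case: (ltnP x j1) => [lt1|/top1->//]; rewrite top2 ?le2.
have flatW : flat M W.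
  apply: flat_indep => x; rewrite inE -leqNgt => le2.
  exists (x |: north_below q j2); split; first exact: setUS.
    apply: indep_labelled => //.
    (* The largest label admissible for [x]; it is at least [height q j2], hence fresh. *)
    apply: (labelled_setU1 (i := (height q x.+1).-1) labW).
      by have := top2_leq x le2; lia.
    by have := hx x; lia.
  by rewrite cardsU1 notin_below // add1n rkW.
have copY : copoint_on M W Y.
  rewrite /copoint_on sWY rkY rkE addn1 hj1 eqxx !andbT.
  apply: flat_indep => x; rewrite inE -leqNgt => le1.
  exists (x |: north_below q j1); split; first exact: setUS.
    apply: indep_labelled => //.
    apply: (labelled_setU1 (i := height q j1) labY) => //.
    by have := hx x; rewrite top1 //; lia.
  by rewrite cardsU1 notin_below // add1n rkY.
split.
- by rewrite /coline flatW rkW rkE addn2 hj2 eqxx.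
- split=> // gap; rewrite /multiple_copoint_on copY /=.
  (* The gap leaves both [j2] and [j2 + 1] below [j1]. *)
  pose x2 := Ordinal lt_j2n.
  have lt_x3 : j2.+1 < n by lia.
  pose x3 := Ordinal lt_x3.
  have : [set x2; x3] \subset Y :\: W.
    by apply/subsetP=> x; rewrite !inE => /orP[]/eqP-> /=; lia.
  move/subset_leq_card; rewrite cards2 -(inj_eq val_inj) /=.
  by rewrite neq_ltn ltnSn.
- move=> k le1.
  have kW : k \notin W by rewrite inE -leqNgt; lia.
  (* Flatness of [W] makes the rank grow, and one added element raises it by at most one. *)
  have rkkW : (rk M (k |: W)).+1 = height q n.
    have := rk_setU1 M k W; have /forall_inP/(_ k kW) := flatW.
    by rewrite rkW -hj2 => lo hi; apply/eqP; rewrite eqSS eqn_leq hi lo.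
  rewrite /simple_copoint_on /copoint_on subsetUr rkE addn1 rkkW eqxx !andbT.
  apply/andP; split; last first.
    by rewrite setDUl setDv setU0 (setDidPl _) ?cards1 // disjoints1.
  apply: flat_indep => x; rewrite !inE negb_or -leqNgt => /andP[neq_xk le2].
  have card_top (y z : 'I_n) : y != z -> j2 <= y -> j2 <= z ->
      #|y |: (z |: north_below q j2)| = height q n.
    move=> neq ley lez; rewrite !cardsU1 in_setU1 negb_or neq.
    by rewrite !notin_below.
  (* Here [y] receives the last label but one, [height q j2], and [z] the last one,
     [height q j1]. *)
  have lab (y z : 'I_n) : y != z -> j2 <= y -> j1 <= z ->
      height p y <= height q j2 -> indep M (y |: (z |: north_below q j2)).
    move=> neq ley lez lepy; rewrite setUCA.
    apply: indep_labelled => //.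
    apply: (labelled_setU1 (i := height q j1)); last 1 first.
    + by have := hx z; rewrite top1 //; lia.
    + apply: (labelled_setU1 (i := height q j2) labW) => //.
      by have := top2_leq y ley; lia.
    + by lia.
  have le2k : j2 <= k by lia.
  exists (x |: (k |: north_below q j2)); split.
  + by rewrite !setUS.
  (* If [x] cannot take the last label but one, only the last remains, which places [x] at or after
     [j1]. As [x] and [k] are not parallel, [k] then admits a smaller label, and the two exchange
     roles. *)
  + have [lepx|gtpx] := leqP (height p x) (height q j2); first exact: lab.
    have le1x : j1 <= x.
      by rewrite leqNgt; apply/negP=> lt1; have := hx x; have := top2 x; lia.
    rewrite setUCA; apply: lab => //; first by rewrite eq_sym.
    have [i [j [neq_ij]]] :=
      height_nonparallel hpq (hloop x) (hloop k) neq_xk (hparallel x k).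
    rewrite !top1 //; lia.
  + by rewrite card_top // -rkkW.
Qed.
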